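(* Let $E$ be a real reflexive Banach space. Let $A\subset E$ be a closed set with $\operatorname{cl}\operatorname{int}A=A$ such that $\partial A$ is a simple smooth closed surface of codimension 1 with function of smoothness $\alpha$ and parameter of simplicity $r>0$. Let $\varepsilon_0=\sup\{t>0:\ \alpha(\tau)+\alpha(\tau/2)<\tfrac12 \text{ for all } \tau\in(0,t)\}$. Then $\partial A$ is weakly convex with modulus of nonconvexity satisfying $\gamma_{\partial A}(\varepsilon)\le\varepsilon\left(\alpha(\varepsilon)+\alpha(\varepsilon/2)\right)$ for all $\varepsilon\in[0,\min\{r,\varepsilon_0\})$.
   Context: $E^*$ is the dual, $(p,x)$ the pairing, $\partial B^*_1(0)$ the unit sphere of $E^*$, $B_r(a)$ the closed ball. For a set $S$ and $x\in S$, the normal cone $N(S,x)$ is the set of $p\in E^*$ for which there is a function $\alpha_x:[0,\operatorname{diam}S)\to[0,\infty)$ with $\lim_{t\to+0}\alpha_x(t)=0$ and $(p,x-a)\ge-\alpha_x(\|x-a\|)\,\|x-a\|\,\|p\|$ for all $a\in S$. $\partial A$ is a smooth closed surface of codimension 1 with function of smoothness $\alpha$ if: $\partial A$ is path connected; for every $x\in\partial A$ there is $p$ with $N(A,x)\cap\partial B^*_1(0)=\{p\}$, $N(\operatorname{cl}(E\setminus A),x)\cap\partial B^*_1(0)=\{-p\}$ and $N(\partial A,x)\cap\partial B^*_1(0)$ equal to the union of these two sets; and $\alpha:[0,\operatorname{diam}A)\to[0,\infty)$ with $\alpha(t)\to0$ as $t\to+0$ satisfies, for every $x\in\partial A$,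 $N(A,x)=\{p:(p,x-a)\ge-\alpha(\|x-a\|)\|x-a\|\|p\|\ \forall a\in A\}$ and $N(\operatorname{cl}(E\setminus A),x)=\{p:(p,x-a)\ge-\alpha(\|x-a\|)\|x-a\|\|p\|\ \forall a\in\operatorname{cl}(E\setminus A)\}$. It is simple with parameter $r>0$ if for every $x\in\partial A$, every unit $p\in N(\partial A,x)$, every $y\in E$ with $\|y\|=(p,y)=1$, and every 2-dimensional affine plane $L\supset\{x,x+y\}$, the set $L\cap\partial A\cap B_r(x)$ is a path connected planar curve. For closed $S$ and $\varepsilon>0$: $\gamma^0_S(\varepsilon)=\inf\{\gamma>0: B_\gamma(\frac{x_1+x_2}{2})\cap S\ne\emptyset\ \forall x_1,x_2\in S,\ \|x_1-x_2\|\le\varepsilon\}$; modulus of nonconvexity $\gamma_S(0)=0$, $\gamma_S(\varepsilon)=\lim_{\tau\downarrow\varepsilon}\gamma^0_S(\tau)$; $S$ is weakly convex on $[0,d')$ if $\gamma_S(\varepsilon)<\varepsilon/2$ for $\varepsilon\in(0,d')$. *)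

(* Defs.v *)
From HB Require Import structures.
From mathcomp Require Import all_boot all_order all_algebra.
From mathcomp Require Import all_classical all_reals all_analysis.
Set Implicit Arguments. Unset Strict Implicit. Unset Printing Implicit Defensive.
Import Order.TTheory GRing.Theory Num.Theory.
Import numFieldNormedType.Exports.
Local Open Scope classical_set_scope.
Local Open Scope ring_scope.

Section Defs.
Context {R : realType} {E : normedModType R}.

Definition is_dual (p : E -> R) : Prop :=
  (forall (a : R) (x y : E), p (a *: x + y) = a * p x + p y) /\ continuous p.

Definition dnorm (p : E -> R) : R :=
  sup [set `|p x| | x in [set x : E | `|x| <= 1]].

Definition reflexive_space : Prop :=
  forall Phi : (E -> R) -> R,
    (forall (a : R) (p q : E -> R), is_dual p -> is_dual q ->
       Phi (fun z => a * p z + q z) = a * Phi p + Phi q) ->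
    (exists C : R, forall p, is_dual p -> `|Phi p| <= C * dnorm p) ->
    exists x : E, forall p, is_dual p -> Phi p = p x.

Definition cball (a : E) (r : R) : set E := [set y | `|y - a| <= r].

Definition diam (S : set E) : \bar R :=
  ereal_sup [set (`|x - y|)%:E | x in S & y in S].

Definition bdry (S : set E) : set E := closure S `\` interior S.

Definition adm_fun (S : set E) (al : R -> R) : Prop :=
  (forall t : R, 0 <= t -> (t%:E < diam S)%E -> 0 <= al t) /\
  (al t @[t --> 0^'+] --> 0).

Definition normal_cone (S : set E) (x : E) : set (E -> R) :=
  [set p | is_dual p /\ exists al : R -> R, adm_fun S al /\
     forall a, S a -> - (al `|x - a|) * `|x - a| * dnorm p <= p (x - a)].

Definition dual_sphere : set (E -> R) := [set p | is_dual p /\ dnorm p = 1].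

Definition path_connected (S : set E) : Prop :=
  forall x y, S x -> S y -> exists c : R -> E,
    {within `[0, 1], continuous c} /\ c 0 = x /\ c 1 = y /\
    (forall t, 0 <= t <= 1 -> S (c t)).

Definition smooth_surface (A : set E) (al : R -> R) : Prop :=
  path_connected (bdry A) /\
  adm_fun A al /\
  (forall x, bdry A x -> exists p : E -> R,
     normal_cone A x `&` dual_sphere = [set p] /\
     normal_cone (closure (~` A)) x `&` dual_sphere = [set (fun z => - p z)] /\
     normal_cone (bdry A) x `&` dual_sphere = [set p] `|` [set (fun z => - p z)]) /\
  (forall x, bdry A x ->
     normal_cone A x = [set p | is_dual p /\ forall a, A a ->
        - (al `|x - a|) * `|x - a| * dnorm p <= p (x - a)] /\
     normal_cone (closure (~` A)) x = [set p | is_dual p /\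
        forall a, closure (~` A) a ->
        - (al `|x - a|) * `|x - a| * dnorm p <= p (x - a)]).

Definition plane2 (L : set E) : Prop :=
  exists c u v : E,
    (forall a b : R, a *: u + b *: v = 0 -> a = 0 /\ b = 0) /\
    L = [set z | exists a b : R, z = c + a *: u + b *: v].

Definition path_connected_curve (C : set E) : Prop :=
  path_connected C /\
  exists (I : interval R) (c : R -> E),
    {within [set` I], continuous c} /\ C = c @` [set` I].

Definition simple_surface (A : set E) (r : R) : Prop :=
  forall x, bdry A x -> forall p, normal_cone (bdry A) x p -> dual_sphere p ->
  forall y : E, `|y| = 1 -> p y = 1 ->
  forall L, plane2 L -> L x -> L (x + y) ->
  path_connected_curve (L `&` bdry A `&` cball x r).

Definition gamma0 (S : set E) (eps : R) : \bar R :=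
  ereal_inf [set g%:E | g in [set g : R | 0 < g /\
     forall x1 x2, S x1 -> S x2 -> `|x1 - x2| <= eps ->
       cball ((2 : R)^-1 *: (x1 + x2)) g `&` S !=set0]].

Definition gammaS (S : set E) (eps : R) : \bar R :=
  if eps == 0 then 0%E else lim (gamma0 S tau @[tau --> eps^'+]).

Definition weakly_convex_on (S : set E) (d : \bar R) : Prop :=
  forall eps : R, 0 < eps -> (eps%:E < d)%E -> (gammaS S eps < (eps / 2)%:E)%E.

(* eps_0 = sup { t > 0 : al tau + al (tau/2) < 1/2 for tau in (0,t) };
   t is restricted to the domain [0, diam A] of al *)
Definition eps0 (A : set E) (al : R -> R) : \bar R :=
  ereal_sup [set t%:E | t in [set t : R | 0 < t /\ (t%:E <= diam A)%E /\
     forall tau, 0 < tau < t -> al tau + al (tau / 2) < 2^-1]].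

End Defs.

(* Main.v *)
Require Import Defs.
From HB Require Import structures.
From mathcomp Require Import all_boot all_order all_algebra.
From mathcomp Require Import all_classical all_reals all_analysis.
From mathcomp Require Import ring lra.
Set Implicit Arguments. Unset Strict Implicit. Unset Printing Implicit Defensive.
Import Order.TTheory GRing.Theory Num.Theory.
Import numFieldNormedType.Exports.
Local Open Scope classical_set_scope.
Local Open Scope ring_scope.

(** Smoothness gives [|p (a - x)| <= al d * d], [d = |a - x|], for [x], [a] on the
    surface and [p] a unit normal at [x]; a point [a] violating this estimate lies
    strictly on one side of the surface.

    For [x1], [x2] on the surface at distance [t], take the radial projection onto
    the sphere of radius [t / 2] around [x1] of a line through [x2] in a direction
    [y] almost norming the normal [p] at [x1].  Its ends lie on different sides of
    the surface, hence it meets the surface in a point [w], and comparing the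
    components of [w - x1] and [(x2 - x1) / 2] along [y] and in [ker p] bounds the
    distance from [w] to the midpoint by about [|p (x2 - x1)| + 2 |p (w - x1)|].

    The modulus at [eps] involves all pairs at distance [t <= tau], [tau] slightly
    above [eps], whereas [al] is neither monotone nor continuous.  So one has to
    show that, up to a small error, [|p (x2 - x1)| <= eps * al eps] for all such
    pairs.  Let [q] be a normal at [x2]: either the swapped pair deviates more from
    its tangent plane, or one can move [x2] along its own tangent plane away from
    [x1] without losing deviation, until the distance is [eps]. *)

(** * Norm-one functionals and vectors that almost norm them *)

Section Functionals.
Context {R : realType} {E : normedModType R}.
Implicit Types (p : E -> R) (x y v : E).

Definition linear_functional p :=
  forall (a : R) x y, p (a *: x + y) = a * p x + p y.

Context {p : E -> R} (plin : linear_functional p).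

Lemma linfun0 : p 0 = 0.
Proof. by have := plin 1 0 0; rewrite scaler0 addr0; lra. Qed.

Lemma linfunZ a x : p (a *: x) = a * p x.
Proof. by have := plin a x 0; rewrite !addr0 linfun0 addr0. Qed.

Lemma linfunD x y : p (x + y) = p x + p y.
Proof. by have := plin 1 x y; rewrite scale1r mul1r. Qed.

Lemma linfunN x : p (- x) = - p x.
Proof. by rewrite -scaleN1r linfunZ mulN1r. Qed.

Lemma linfunB x y : p (x - y) = p x - p y.
Proof. by rewrite linfunD linfunN. Qed.

Lemma linfun_normB x y : `|p (x - y)| = `|p (y - x)|.
Proof. by rewrite -opprB linfunN normrN. Qed.

Lemma dnorm1_le : dnorm p = 1 -> forall x, `|p x| <= `|x|.
Proof.
move=> p1 x; have [->|x0] := eqVneq x 0; first by rewrite linfun0 !normr0.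
(* A set without supremum has [sup] equal to 0 by default, so [dnorm p = 1] forces boundedness. *)
have hs : has_sup [set `|p z| | z in [set z : E | `|z| <= 1]].
  by apply: contrapT => /sup_out; rewrite -/(dnorm p) p1 => /eqP; rewrite oner_eq0.
have nx : 0 < `|x| by rewrite normr_gt0.
have : `|p (`|x|^-1 *: x)| <= 1.
  rewrite -p1; apply: ub_le_sup; first by case: hs.
  exists (`|x|^-1 *: x) => //=.
  by rewrite normrZ normfV normr_id mulVf // gt_eqF.
by rewrite linfunZ normrM normfV normr_id mulrC ler_pdivrMr // mul1r.
Qed.

(** A vector [x] of the unit ball with [|p x| > 1 / (1 + mu)] is divided by its value [p x]. *)
Lemma dnorm1_almost_attained : dnorm p = 1 ->
  forall mu, 0 < mu -> exists2 y, p y = 1 & `|y| <= 1 + mu.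
Proof.
move=> p1 mu mu0.
have hs : has_sup [set `|p z| | z in [set z : E | `|z| <= 1]].
  by apply: contrapT => /sup_out; rewrite -/(dnorm p) p1 => /eqP; rewrite oner_eq0.
have e0 : 0 < mu / (1 + mu) by rewrite divr_gt0 //; lra.
have [_ [x /= x1 <-]] := sup_adherent e0 hs.
rewrite -/(dnorm p) p1 => px.
have e1 : 1 - mu / (1 + mu) = (1 + mu)^-1 by field; lra.
rewrite e1 in px.
have i0 : 0 < (1 + mu)^-1 by rewrite invr_gt0; lra.
have px0 : 0 < `|p x| by lra.
exists ((p x)^-1 *: x).
  by rewrite linfunZ mulVf // -normr_gt0.
rewrite normrZ normfV mulrC ler_pdivrMr //.
have : 1 <= (1 + mu) * `|p x|.
  rewrite -ler_pdivrMl; last by lra.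
  by rewrite mulr1 ltW.
lra.
Qed.

End Functionals.

(** * Crossing the boundary along a path *)

Section Crossing.
Context {R : realType} {E : normedModType R}.

(** If the path missed the boundary, [A] and its interior would cut the same part out of the image:
    relatively open and closed, hence everything by connectedness. *)
Lemma path_meets_bdry (A : set E) (z : R -> E) (a b : R) :
  closed A -> continuous z -> a <= b -> A (z a) -> ~ A (z b) ->
  exists2 s, a <= s <= b & bdry A (z s).
Proof.
move=> cA cz ab Aza nAzb; apply: contrapT => noS.
have conn : connected (z @` `[a, b]).
  apply: connected_continuous_connected; first exact: segment_connected.
  exact: continuous_subspaceT.
have eqZ : z @` `[a, b] `&` A = z @` `[a, b].
  apply: conn; last by exists A.
    by exists (z a); split => //; exists a => //=; rewrite in_itv /= lexx ab.
  exists (interior A); first exact: open_interior.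
  apply/seteqP; split => _ [[s sab <-] As]; split; [by exists s| |by exists s|].
    apply: contrapT => nI; apply: noS; exists s; first by rewrite /= in_itv in sab.
    by split => //; exact: subset_closure.
  exact: interior_subset.
have : (z @` `[a, b]) (z b) by exists b => //=; rewrite in_itv /= lexx ab.
by rewrite -eqZ => -[].
Qed.

Lemma radial_path_continuous (x X y : E) (rho : R) :
  (forall s : R, X + s *: y != 0) ->
  continuous (fun s : R => x + (rho / `|X + s *: y|) *: (X + s *: y)).
Proof.
move=> nz s.
have c1 : (X + u *: y) @[u --> s] --> X + s *: y.
  by apply: cvgD; [exact: cvg_cst|apply: cvgZr_tmp; exact: cvg_id].
apply: cvgD; first exact: cvg_cst.
apply: cvgZ => //; apply: cvgM; first exact: cvg_cst.
apply: cvgV; first by rewrite normr_eq0.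
exact: cvg_norm.
Qed.

(** [X = - s y] would give [p X = - s] and [|X| = |s| |y| <= 2 |p X|]. *)
Lemma affine_line_neq0 (p : E -> R) (X y : E) (s : R) : linear_functional p ->
  p y = 1 -> `|y| <= 1 + 1 -> 2 * `|p X| < `|X| -> X + s *: y != 0.
Proof.
move=> pl py y1 pX; apply/eqP => /eqP; rewrite addr_eq0 => /eqP Xs.
have : p X = - s by rewrite Xs (linfunN pl) (linfunZ pl) py mulr1.
have : `|X| = `|s| * `|y| by rewrite Xs normrN normrZ.
move=> nX ps; rewrite ps normrN in pX.
have := normr_ge0 s; nra.
Qed.

End Crossing.

(** * Unit normals and surface points near a midpoint *)

Section Surface.
Context {R : realType} {E : normedModType R} (A : set E) (al : R -> R).

(** The last two fields say that [p] is normal to [A] and [-p] to the closed complement, written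
    with [a - x] for [x - a]; norm one enters through the second and third. *)
Record unit_normal (x : E) (p : E -> R) : Prop := UnitNormal {
  normal_lin : linear_functional p;
  normal_le : forall v, `|p v| <= `|v|;
  normal_attained : forall mu, 0 < mu -> exists2 y, p y = 1 & `|y| <= 1 + mu;
  normal_in : forall a, A a -> p (a - x) <= al `|a - x| * `|a - x|;
  normal_out : forall a, closure (~` A) a ->
    - (al `|a - x| * `|a - x|) <= p (a - x) }.

Lemma smooth_surface_normal (x : E) :
  smooth_surface A al -> bdry A x -> exists p, unit_normal x p.
Proof.
move=> [_ [_ [exN eqN]]] Sx; have [p [pA [pC _]]] := exN x Sx.
have [eA eC] := eqN x Sx.
have [Np [[pl _] p1]] : (normal_cone A x `&` dual_sphere) p by rewrite pA.
have [Nq [_ q1]] :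
    (normal_cone (closure (~` A)) x `&` dual_sphere) (fun z => - p z).
  by rewrite pC.
rewrite eA in Np; rewrite eC in Nq.
exists p; split => //.
- exact: dnorm1_le.
- exact: dnorm1_almost_attained.
- move=> a Aa; have := Np.2 a Aa; rewrite p1 mulr1 -opprB normrN (linfunN pl).
  lra.
- move=> a Ca; have := Nq.2 a Ca; rewrite q1 mulr1 -opprB normrN (linfunN pl).
  lra.
Qed.

Context (clA : closed A).

Lemma bdry_in x : bdry A x -> A x.
Proof. by move=> [+ _]; rewrite -((closure_id A).1 clA). Qed.

Lemma bdry_out x : bdry A x -> closure (~` A) x.
Proof. by move=> [_ nI]; rewrite closure_setC. Qed.

Lemma bdry_near_tangent x a p : unit_normal x p -> bdry A a ->
  `|p (a - x)| <= al `|a - x| * `|a - x|.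
Proof.
move=> np Sa; rewrite ler_norml (normal_out np (bdry_out Sa)).
exact: (normal_in np (bdry_in Sa)).
Qed.

(* The point is sought on the part of the sphere of radius [rho] around [x]
   that is the radial projection of the segment [[X - T y, X + T y]]; at its two
   ends the tangent plane at [x0] decides on which side of the surface we are. *)
Lemma sphere_meets_bdry (x0 x X y : E) (p : E -> R) (rho T : R) :
  let z s := x + (rho / `|X + s *: y|) *: (X + s *: y) in
  unit_normal x0 p -> (forall s : R, X + s *: y != 0) -> 0 <= T ->
  al `|z T - x0| * `|z T - x0| < p (z T - x0) ->
  p (z (- T) - x0) < - (al `|z (- T) - x0| * `|z (- T) - x0|) ->
  exists2 s, - T <= s <= T & bdry A (z s).
Proof.
move=> z np nz T0 zT zNT; apply: path_meets_bdry => //.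
- exact: radial_path_continuous.
- lra.
- apply: contrapT => nA; move: zNT; rewrite ltNge.
  by rewrite (normal_out np) //; exact: subset_closure.
- by move=> AzT; move: zT; rewrite ltNge (normal_in np).
Qed.

Lemma radial_norm (X y : E) (rho s : R) : X + s *: y != 0 -> 0 <= rho ->
  `|(rho / `|X + s *: y|) *: (X + s *: y)| = rho.
Proof.
move=> nz rho0; rewrite normrZ ger0_norm ?divr_ge0 // divfK //.
by rewrite normr_eq0.
Qed.

(** Both [w - x1] and [(x2 - x1) / 2] have length [t / 2], and their projections to [ker p] along
    [y] point the same way. These therefore differ only in length, which the deviations control. *)
Lemma midpoint_near_bdry (x1 x2 : E) (p : E -> R) (mu : R) :
  unit_normal x1 p -> 0 < mu -> mu <= 1 / 100 -> x1 != x2 ->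
  2 * `|p (x2 - x1)| < `|x2 - x1| -> al (`|x2 - x1| / 2) <= 1 / 2 ->
  exists w, [/\ bdry A w, `|w - x1| = `|x2 - x1| / 2 &
    `|w - 2^-1 *: (x1 + x2)| <=
      (1 + mu) * (`|p (x2 - x1)| + 2 * `|p (w - x1)|)].
Proof.
move=> np mu0 mu1 x12 pX al2; have pl := normal_lin np.
have [y py y1] := normal_attained np mu0.
have t0 : 0 < `|x2 - x1| by rewrite normr_gt0 subr_eq0 eq_sym.
have [X XE] : exists X, X = x2 - x1 by exists (x2 - x1).
move: pX al2 t0; rewrite -XE; set t := `|X| => pX al2 t0.
have nz s : X + s *: y != 0 by apply: (affine_line_neq0 _ pl) => //; lra.
have n0 s : 0 < `|X + s *: y| by rewrite normr_gt0.
have r0 : 0 <= t / 2 by lra.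
have pz s : p ((t / 2 / `|X + s *: y|) *: (X + s *: y)) =
    (t / 2 / `|X + s *: y|) * (p X + s).
  by rewrite (linfunZ pl) (linfunD pl) (linfunZ pl) py mulr1.
have pXb : - (t / 2) < p X < t / 2 by rewrite -ltr_norml; lra.
(* At the ends [s = 10 t] and [s = - 10 t], [|p|] exceeds [t / 4] on the projected vector, while the
   tolerance [al (t / 2) * (t / 2)] is at most [t / 4]. *)
have nb s : `|s| = 10 * t -> `|X + s *: y| <= 12 * t.
  move=> hs; rewrite (le_trans (ler_normD _ _)) // normrZ hs -/t.
  nra.
have frac s : `|s| = 10 * t -> (t / 2 / `|X + s *: y|) * (9 * t) > t / 2 / 2.
  move=> hs; have := nb _ hs; have := n0 s; set n := `|_ + _| => ngt0 nle.
  rewrite [ltRHS]mulrAC ltr_pdivlMr //; nra.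
have [|||s sT Sw] := @sphere_meets_bdry x1 x1 X y p (t / 2) (10 * t) np nz.
- lra.
- rewrite addrC addKr radial_norm // pz.
  have hs : `|10 * t| = 10 * t by rewrite ger0_norm; lra.
  have := frac _ hs; have := n0 (10 * t); set n := `|_ + _| => ngt0 fr.
  have c0 : 0 < t / 2 / n by rewrite divr_gt0; lra.
  nra.
- rewrite addrC addKr radial_norm // pz.
  have hs : `|- (10 * t)| = 10 * t by rewrite normrN ger0_norm; lra.
  have := frac _ hs; have := n0 (- (10 * t)); set n := `|_ + _| => ngt0 fr.
  have c0 : 0 < t / 2 / n by rewrite divr_gt0; lra.
  nra.
set v := (t / 2 / `|X + s *: y|) *: (X + s *: y) in Sw.
have nv : `|v| = t / 2 by exact: radial_norm.
exists (x1 + v); rewrite [x1 + v - x1]addrC addKr; split => //.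
pose c := t / 2 / `|X + s *: y|.
have c0 : 0 < c by rewrite divr_gt0 //; lra.
pose u0 := 2^-1 *: X - p (2^-1 *: X) *: y.
pose v0 := v - p v *: y.
have v0E : v0 = (2 * c) *: u0.
  rewrite /v0 /u0 /v pz -/c (linfunZ pl) !scalerDr !scalerN !scalerA.
  rewrite -addrA -scalerBl.
  congr (_ *: _ + _); first by field.
  by rewrite -scaleNr; congr (_ *: _); field.
have u0v0 : `|v0 - u0| = `| `|v0| - `|u0| |.
  have -> : v0 - u0 = (2 * c - 1) *: u0 by rewrite v0E scalerBl scale1r.
  rewrite v0E normrZ [`|(2 * c) *: u0|]normrZ [`|2 * c|]ger0_norm; last by lra.
  by rewrite -{3}[`|u0|]mul1r -mulrBl normrM normr_id.
have nX : `|2^-1 *: X| = t / 2 by rewrite normrZ ger0_norm // mulrC.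
have dv0 : `| `|v0| - t / 2 | <= `|p v| * (1 + mu).
  rewrite -nv (le_trans (ler_dist_dist _ _)) // /v0 addrC addKr normrN normrZ.
  by rewrite ler_wpM2l.
have du0 : `| `|u0| - t / 2 | <= `|p X| / 2 * (1 + mu).
  rewrite -nX (le_trans (ler_dist_dist _ _)) // /u0 addrC addKr normrN normrZ.
  rewrite (linfunZ pl) normrM ger0_norm // [_^-1 * _]mulrC.
  by rewrite ler_wpM2l // mulr_ge0.
have dvu : `|v0 - u0| <= (`|p v| + `|p X| / 2) * (1 + mu).
  rewrite u0v0 (le_trans (ler_distD (t / 2) _ _)) // mulrDl lerD //.
  by rewrite distrC.
have -> : x1 + v - 2^-1 *: (x1 + x2) = (v0 - u0) + (p v - p (2^-1 *: X)) *: y.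
  have -> : 2^-1 *: (x1 + x2) = x1 + 2^-1 *: X.
    have -> : x2 = x1 + X by rewrite XE addrC subrK.
    rewrite addrA scalerDr -mulr2n -[x1 *+ 2]scaler_nat scalerA mulVf ?scale1r //.
  rewrite /v0 /u0 scalerBl opprD addrA [x1 + v]addrC addrK.
  by rewrite opprB [RHS]addrAC !addrA !subrK.
rewrite (le_trans (ler_normD _ _)) // normrZ.
have : `|p v - p (2^-1 *: X)| <= `|p v| + `|p X| / 2.
  rewrite (le_trans (ler_normB _ _)) // (linfunZ pl 2^-1 X) [`|2^-1 * _|]normrM [`|2^-1|]ger0_norm //.
  by rewrite [_^-1 * _]mulrC.
have := normr_ge0 (p v); have := normr_ge0 (p X).
have := normr_ge0 (p v - p (2^-1 *: X)); have := normr_ge0 y.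
nra.
Qed.

End Surface.

(** * Moving a surface point to a prescribed distance *)

Section Step.
Context {R : realType} {E : normedModType R} (A : set E) (al : R -> R).
Context (clA : closed A).

(** Meant for [n = |X + s y|] with [|s| <= 4 d] and [|y| <= 1.01], whence the 4.04. *)
Lemma radial_factor_bounds (t rho n d : R) :
  0 < d -> 100 * d <= t -> `|rho - t| <= d -> `|n - t| <= 404 / 100 * d ->
  `|rho / n - 1| * t <= 53 / 10 * d.
Proof.
move=> d0 dt; rewrite !ler_norml => /andP[r1 r2] /andP[n1 n2].
have n0 : 0 < n by lra.
have -> : rho / n - 1 = (rho - n) / n by field; lra.
rewrite normrM normfV [`|n|]gtr0_norm // mulrAC ler_pdivrMr //.
have : `|rho - n| <= 504 / 100 * d by rewrite ler_norml; lra.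
have := normr_ge0 (rho - n); nra.
Qed.

(** The vector multiplied by [m] lies in [ker q], so [th = q (z - x2)]. As [z] stays within [10 d]
    of [x2], where [al] is at most [ka], this normal error is small against [d]. *)
Lemma bdry_step (x1 x2 y : E) (q : E -> R) (rho d ka : R) :
  unit_normal A al x2 q -> q y = 1 -> `|y| <= 101 / 100 ->
  2 * `|q (x2 - x1)| < `|x2 - x1| ->
  0 < d -> 100 * d <= `|x2 - x1| -> `|rho - `|x2 - x1| | <= d ->
  (forall s, 0 < s < 10 * d -> al s <= ka) -> 0 < ka <= 1 / 20 ->
  exists z m th, [/\ bdry A z, `|z - x1| = rho,
    z - x1 = (x2 - x1) + m *: ((x2 - x1) - q (x2 - x1) *: y) + th *: y,
    `|th| <= 10 * ka * d /\ `|m| * `|x2 - x1| <= 6 * d &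
    rho = `|x2 - x1| + d -> 0 <= m].
Proof.
move=> nq qy y1 + d0; have ql := normal_lin nq.
have [X XE] : exists X, X = x2 - x1 by exists (x2 - x1).
rewrite -XE; have [t tE] : exists t, t = `|X| by exists `|X|.
rewrite -tE => qX dt rhot alka /andP[ka0 ka1].
have t0 : 0 < t by lra.
have nz s : X + s *: y != 0 by apply: (affine_line_neq0 _ ql) => //; lra.
have rho0 : 0 <= rho by move: rhot; rewrite ler_norml; lra.
have qXb : - (t / 2) < q X < t / 2 by rewrite -ltr_norml; lra.
have [c cE] : exists c : R -> R, forall s, c s = rho / `|X + s *: y|.
  by exists (fun s => rho / `|X + s *: y|).
pose z s := x1 + c s *: (X + s *: y).
have zx1 s : z s - x1 = c s *: (X + s *: y) by rewrite /z addrC addKr.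
have zx2 s : z s - x2 = (c s - 1) *: X + (c s * s) *: y.
  have -> : x2 = x1 + X by rewrite XE addrC subrK.
  by rewrite opprD addrA zx1 scalerBl scale1r scalerDr scalerA addrAC.
have qz s : q (z s - x2) = (c s - 1) * q X + c s * s.
  by rewrite zx2 (linfunD ql) !(linfunZ ql) qy mulr1.
have cb s : `|s| <= 4 * d -> `|c s - 1| * t <= 53 / 10 * d.
  move=> sd; rewrite cE; apply: radial_factor_bounds => //.
  rewrite tE (le_trans (ler_dist_dist _ _)) // [_ - X]addrC addKr normrZ.
  have := normr_ge0 s; have := normr_ge0 y; nra.
have c1 s : `|s| <= 4 * d -> `|c s - 1| <= 53 / 1000.
  move=> sd; have := cb s sd; have := normr_ge0 (c s - 1); nra.
have zd s : `|s| <= 4 * d -> `|z s - x2| < 10 * d.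
  move=> sd; rewrite zx2 (le_lt_trans (ler_normD _ _)) // !normrZ -tE.
  rewrite ?normrM; have := cb s sd; have := c1 s sd.
  have : `|c s| <= `|c s - 1| + 1.
    by rewrite -{1}[c s](subrK 1) (le_trans (ler_normD _ _)) // normr1.
  have := normr_ge0 (c s); have := normr_ge0 s; have := normr_ge0 y.
  move=> y0 s0 cs0 h1 h2 h3.
  have : `|c s| * `|s| <= 1053 / 1000 * (4 * d) by nra.
  have : 0 <= `|c s| * `|s| by exact: mulr_ge0.
  nra.
have alz s : `|s| <= 4 * d -> al `|z s - x2| * `|z s - x2| <= 10 * ka * d.
  move=> sd; have [->|nz0] := eqVneq (z s - x2) 0.
    by rewrite normr0 mulr0; nra.
  have n0 : 0 < `|z s - x2| by rewrite normr_gt0.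
  have zs := zd s sd.
  have : al `|z s - x2| <= ka by apply: alka; rewrite n0.
  nra.
have kb s : `|s| <= 4 * d -> - (53 / 20 * d) <= (c s - 1) * q X <= 53 / 20 * d.
  move=> sd; rewrite -ler_norml normrM.
  have := cb s sd; have := normr_ge0 (c s - 1); have := normr_ge0 (q X).
  nra.
have T1 : `|4 * d| <= 4 * d by rewrite ger0_norm //; lra.
have T2 : `|- (4 * d)| <= 4 * d by rewrite normrN.
have cl s : `|s| <= 4 * d -> 947 / 1000 <= c s.
  by move=> sd; have := c1 s sd; rewrite ler_norml; lra.
have kad : 10 * ka * d <= d / 2 by nra.
(* At both ends [c s * s] has size at least [3.788 d], beating the [2.65 d] of the other term plus
   the tolerance [d / 2]. *)
have [|||s sT Sz] := @sphere_meets_bdry _ _ A al clA x2 x1 X y q rho (4 * d) nq nz.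
- lra.
- rewrite -cE -/(z (4 * d)) qz.
  have := alz _ T1; have := kb _ T1; have := cl _ T1; nra.
- rewrite -cE -/(z (- (4 * d))) qz.
  have := alz _ T2; have := kb _ T2; have := cl _ T2; nra.
rewrite -cE -/(z s) in Sz.
have sd : `|s| <= 4 * d by rewrite ler_norml.
have nzs : `|z s - x1| = rho by rewrite zx1 cE radial_norm.
have zE : z s - x1 = X + (c s - 1) *: (X - q X *: y) + q (z s - x2) *: y.
  rewrite zx1 qz scalerDr scalerA [in RHS]scalerDl scalerBr [in RHS]scalerA.
  by rewrite !addrA subrK scalerBl scale1r [X + _]addrC subrK.
have thle : `|q (z s - x2)| <= 10 * ka * d.
  exact: le_trans (bdry_near_tangent clA nq Sz) (alz s sd).
exists (z s), (c s - 1), (q (z s - x2)); split => //.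
  by split => //; have := cb s sd; lra.
(* For [c s < 1] the tangential part is no longer than [t], and the normal error has length below
   [d], so [t + d] is out of reach. *)
move=> rhoE; rewrite leNgt; apply/negP => m0.
have : rho <= `|X + (c s - 1) *: (X - q X *: y)| + `|q (z s - x2) *: y|.
  by rewrite -nzs zE ler_normD.
have -> : X + (c s - 1) *: (X - q X *: y) = c s *: X + ((1 - c s) * q X) *: y.
  rewrite scalerBr scalerA addrA -scaleNr; congr (_ + _ *: _); last by ring.
  by rewrite scalerBl scale1r addrC subrK.
have := ler_normD (c s *: X) (((1 - c s) * q X) *: y).
rewrite !normrZ ?normrM -tE [`|c s|]ger0_norm; last by have := cl s sd; lra.
rewrite [`|1 - _|]ger0_norm; last by lra.
move=> h1 h2.
have : (1 - c s) * `|q X| <= (1 - c s) * (t / 2) by rewrite ler_wpM2l //; lra.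
have : 0 <= (1 - c s) * `|q X| by rewrite mulr_ge0 //; lra.
have := normr_ge0 y; have := normr_ge0 (q (z s - x2)).
nra.
Qed.
End Step.

(** * Uniform bound on the deviation from tangent planes *)

Section Deviation.
Context {R : realType} {E : normedModType R} (A : set E) (al : R -> R) (t0 : R).
Context (clA : closed A).
Context (exN : forall x, bdry A x -> exists p, unit_normal A al x p).
Context (al_ge0 : forall t, 0 <= t < t0 -> 0 <= al t).
Context (al_half : forall t, 0 < t < t0 -> al t + al (t / 2) < 2^-1).
Context (al_small : forall ka, 0 < ka ->
  exists2 d, 0 < d & forall s, 0 < s < d -> al s <= ka).

Lemma tangent_deviation_lt_half (x1 x2 : E) (p : E -> R) :
  bdry A x2 -> unit_normal A al x1 p -> 0 < `|x2 - x1| < t0 ->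
  2 * `|p (x2 - x1)| < `|x2 - x1|.
Proof.
move=> S2 np; have := bdry_near_tangent clA np S2.
set t := `|x2 - x1| => pX /andP[tgt0 tlt].
have : al t + al (t / 2) < 2^-1 by apply: al_half; rewrite tgt0.
have : 0 <= al (t / 2) by apply: al_ge0; lra.
nra.
Qed.

(* Maximise, up to a small error, the deviation plus [kap] times the distance
   over all pairs at distance at most [eps + d].  Since the swapped pair does no
   better, a step away from [x1] inside the tangent plane at [x2] loses almost no
   deviation, so the penalty forces the distance to be at least [eps]; a last
   step then makes it exactly [eps], the only distance at which [al eps] says
   something. *)
Lemma tangent_deviation_bound (eps eta : R) : 0 < eps < t0 -> 0 < eta ->
  exists2 d, 0 < d < t0 - eps & forall (x1 x2 : E) (p : E -> R),
    bdry A x1 -> bdry A x2 -> unit_normal A al x1 p -> `|x2 - x1| <= eps + d ->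
    `|p (x2 - x1)| <= eps * al eps + eta.
Proof.
move=> /andP[e0 et] eta0.
have ale : 0 <= eps * al eps by rewrite mulr_ge0 // ?al_ge0 ?et ?ltW.
have [kap [kap0 kap1 kap2]] : exists kap : R,
    [/\ 0 < kap, kap <= 1 / 2 & kap * (eps + 1) <= eta / 4].
  exists (Num.min (1 / 2) (eta / 4 / (eps + 1))); split.
  - by rewrite lt_min !divr_gt0 //; lra.
  - by rewrite ge_min lexx.
  - by rewrite -ler_pdivlMr ?ge_min ?lexx ?orbT //; lra.
have [d1 d10 al_d1] : exists2 d, 0 < d & forall s, 0 < s < d -> al s <= kap / 40.
  by apply: al_small; lra.
have [d [d0 dd1 dB]] : exists d : R,
    [/\ 0 < d, d <= d1 / 10 & [/\ d <= eta / 400, d <= 1 / 2 & d < t0 - eps]].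
  exists (Num.min (Num.min (d1 / 10) (eta / 400))
                  (Num.min (1 / 2) ((t0 - eps) / 2))).
  split; [|by rewrite !ge_min lexx|split].
  - rewrite !lt_min -!andbA; apply/and4P; split; lra.
  - by rewrite !ge_min lexx !orbT.
  - by rewrite !ge_min lexx !orbT.
  - rewrite !gt_min; apply/orP; right; apply/orP; right; lra.
case: dB => d_eta d_half d_t0.
have al_d s : 0 < s < 10 * d -> al s <= kap / 40.
  by move=> sd; apply: al_d1; lra.
pose G := [set h : R | exists x1 x2 p, [/\ bdry A x1, bdry A x2,
   unit_normal A al x1 p, `|x2 - x1| <= eps + d &
   h = `|p (x2 - x1)| + kap * `|x2 - x1|]].
have Gub : has_ubound G.
  exists (2 * (eps + d)) => _ [x1 [x2 [p [_ _ np le ->]]]].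
  have := normal_le np (x2 - x1); have := normr_ge0 (x2 - x1); nra.
suff supG : G !=set0 -> sup G <= eps * al eps + eta.
  exists d => [|x1 x2 p S1 S2 np le]; first by rewrite d0 d_t0.
  have Gh : G (`|p (x2 - x1)| + kap * `|x2 - x1|) by exists x1, x2, p.
  have := ub_le_sup Gub Gh; have := supG (ex_intro _ _ Gh).
  have : 0 <= kap * `|x2 - x1| by rewrite mulr_ge0 // ltW.
  lra.
move=> G0; have ee : 0 < kap * d / 8 by rewrite divr_gt0 ?mulr_gt0.
have [_ [x1 [x2 [p [S1 S2 np le ->]]]]] := sup_adherent ee (conj G0 Gub).
move: le; set M := sup G; set X := x2 - x1; set t := `|X| => le Mlt.
have GM h : G h -> h <= M by exact: ub_le_sup.
have kd : kap * d <= d / 2 by nra.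
have pXt : `|p X| <= t by exact: normal_le np _.
have tge0 : 0 <= t by exact: normr_ge0.
(* For short pairs deviation and penalty are each at most [t < 100 d <= eta / 4]. *)
have [tsmall|tbig] := ltP t (100 * d).
  have : kap * t <= t by nra.
  lra.
have [q nq] := exN S2.
have ql := normal_lin nq; have pl := normal_lin np.
have ka0 : 0 < kap / 100 by lra.
have [y qy y1] := normal_attained nq ka0.
have tt : 0 < t < t0 by apply/andP; split; lra.
have pX2 : 2 * `|p X| < t by exact: tangent_deviation_lt_half.
have qX2 : 2 * `|q X| < t.
  have := @tangent_deviation_lt_half x2 x1 q S1 nq.
  by rewrite (linfun_normB ql) distrC; apply.
have qXM : `|q X| + kap * t <= M.
  apply: GM; exists x2, x1, q; split => //; first by rewrite distrC.
  by rewrite (linfun_normB ql) [`|x1 - x2|]distrC.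
have qXp : `|q X| <= `|p X| + kap * d / 8 by lra.
have py : `|p y| <= 1 + kap / 100 by exact: le_trans (normal_le np y) y1.
have py2 : `|p y| <= 101 / 100 by lra.
have pz z m th : z - x1 = X + m *: (X - q X *: y) + th *: y ->
    p (z - x1) = p X + m * (p X - q X * p y) + th * p y.
  by move=> ->; rewrite !(linfunD pl, linfunZ pl, linfunN pl).
have qpy : `|q X * p y| <= `|q X| * (1 + kap / 100).
  by rewrite normrM ler_wpM2l.
have [tlt|tge] := ltP t eps.
  exfalso.
  (* Stepping out to [t + d] gains [kap * d] in penalty. It loses at most [0.29 kap d] of deviation,
     and [x1], [x2] miss the supremum by less than [kap * d / 8]: a contradiction. *)
  have [||||z [m [th [Sz nz zE [thle mle] mge]]]] :=
    @bdry_step _ _ A al clA x1 x2 y q (t + d) d (kap / 40) nq qy _ qX2 d0 tbig.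
  - lra.
  - by rewrite -/X -/t addrAC subrr add0r gtr0_norm.
  - exact: al_d.
  - lra.
  rewrite -/X -/t in mle mge zE; have m0 := mge erefl.
  rewrite ger0_norm // in mle.
  have FM : `|p (z - x1)| + kap * (t + d) <= M.
    by apply: GM; exists x1, z, p; split => //; rewrite nz //; lra.
  have low : `|p X| + m * `|p X| - m * `|q X * p y| - `|th| * `|p y| <=
      `|p (z - x1)|.
    have -> : `|p X| + m * `|p X| = `|p (z - x1) + m * (q X * p y) - th * p y|.
      have -> : p (z - x1) + m * (q X * p y) - th * p y = (1 + m) * p X.
        by rewrite (pz _ _ _ zE); ring.
      by rewrite normrM ger0_norm ?mulrDl ?mul1r //; lra.
    have := ler_normB (p (z - x1) + m * (q X * p y)) (th * p y).
    have := ler_normD (p (z - x1)) (m * (q X * p y)).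
    by rewrite [`|m * _|]normrM [`|th * _|]normrM [`|m|]ger0_norm //; lra.
  have m1 : m <= 6 / 100.
    by rewrite -(ler_pM2r d0); have := ler_wpM2l m0 tbig; lra.
  have thp : `|th| * `|p y| <= 10 * (kap / 40) * d * (101 / 100).
    exact: ler_pM.
  have mq : m * `|q X * p y| <= m * `|q X| + m * `|q X| * (kap / 100).
    have := ler_wpM2l m0 qpy; lra.
  have mqX : m * `|q X| <= 3 * d by have := ler_wpM2l m0 (ltW qX2); lra.
  have mqk : m * `|q X| * (kap / 100) <= 3 * d * (kap / 100).
    by rewrite ler_wpM2r //; lra.
  have mqp : m * `|q X| <= m * `|p X| + m * (kap * d / 8).
    by rewrite -mulrDr ler_wpM2l.
  have : m * (kap * d / 8) <= 6 / 100 * (kap * d / 8).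
    by rewrite ler_wpM2r // ltW.
  lra.
(* Now the step goes to distance exactly [eps]. It changes the deviation by at most [12 d] plus a
   multiple of [kap * d], absorbed by [eta]. *)
have [||||z [m [th [Sz nz zE [thle mle] _]]]] :=
  @bdry_step _ _ A al clA x1 x2 y q eps d (kap / 40) nq qy _ qX2 d0 tbig.
- lra.
- by rewrite -/X -/t ler_norml; lra.
- exact: al_d.
- lra.
rewrite -/X -/t in mle zE.
have up : `|p X| <= `|p (z - x1)| + `|m| * (`|p X| + `|q X * p y|) +
    `|th| * `|p y|.
  have pXE : p X = p (z - x1) - m * (p X - q X * p y) - th * p y.
    by rewrite (pz _ _ _ zE); ring.
  rewrite {1}pXE (le_trans (ler_normB _ _)) // [`|th * _|]normrM lerD2r.
  rewrite (le_trans (ler_normB _ _)) // [`|m * _|]normrM lerD2l.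
  by rewrite ler_wpM2l // ler_normB.
have := bdry_near_tangent clA np Sz; rewrite nz => pzle.
have thp : `|th| * `|p y| <= 10 * (kap / 40) * d * (101 / 100).
  exact: ler_pM.
have : `|m| * (`|p X| + `|q X * p y|) <= `|m| * (2 * t).
  rewrite ler_wpM2l //; have : `|q X| * (1 + kap / 100) <= `|q X| * 2.
    by rewrite ler_wpM2l //; lra.
  lra.
have : kap * t <= kap * (eps + 1) by rewrite ler_wpM2l //; lra.
lra.
Qed.

End Deviation.

(** * The modulus of nonconvexity as a right limit *)

Lemma gamma0_le (R : realType) (E : normedModType R) (S : set E) (t u : R) :
  t <= u -> (gamma0 S t <= gamma0 S u)%E.
Proof.
move=> tu; apply: le_ereal_inf => _ [g [g0 gP] <-]; exists g => //.
by split => // x1 x2 S1 S2 le; apply: gP => //; exact: le_trans le tu.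
Qed.

(** By monotonicity the right limit is an infimum over larger arguments. *)
Lemma gammaS_le_gamma0 (R : realType) (E : normedModType R) (S : set E)
    (eps d : R) :
  0 < eps -> 0 < d -> (gammaS S eps <= gamma0 S (eps + d))%E.
Proof.
move=> e0 d0; rewrite /gammaS gt_eqF //.
have := @nondecreasing_at_right_cvge R (gamma0 S) eps +oo%O erefl.
move=> /(_ _)/cvg_lim -> //; last by move=> ? ? _ _; exact: gamma0_le.
apply: ereal_inf_lbound; exists (eps + d) => //=.
by rewrite in_itv /= andbT ltrDl.
Qed.

(** * The modulus of the surface *)

Section Modulus.
Context {R : realType} {E : normedModType R} (A : set E) (al : R -> R) (t0 : R).
Context (clA : closed A).
Context (exN : forall x, bdry A x -> exists p, unit_normal A al x p).
Context (al_ge0 : forall t, 0 <= t < t0 -> 0 <= al t).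
Context (al_half : forall t, 0 < t < t0 -> al t + al (t / 2) < 2^-1).
Context (al_small : forall ka, 0 < ka ->
  exists2 d, 0 < d & forall s, 0 < s < d -> al s <= ka).

(** The deviation bound is used at [eps] for [x2] and at [eps / 2] for the point [w] near the
    midpoint; one radius then serves all pairs up to distance [eps + d]. *)
Lemma gammaS_bdry_le (eps : R) : 0 < eps < t0 ->
  (gammaS (bdry A) eps <= (eps * (al eps + al (eps / 2)))%:E)%E.
Proof.
move=> et; apply/lee_addgt0Pr => eta eta0.
have et2 : 0 < eps / 2 < t0 by lra.
have eta8 : 0 < eta / 8 by lra.
have [d1 d1b dev1] :=
  tangent_deviation_bound clA exN al_ge0 al_half al_small et eta8.
have [d2 d2b dev2] :=
  tangent_deviation_bound clA exN al_ge0 al_half al_small et2 eta8.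
have [d [d0 dd1 dd2]] : exists d : R, [/\ 0 < d, d <= d1 & d <= d2].
  exists (Num.min d1 d2); rewrite lt_min !ge_min !lexx orbT.
  by split => //; lra.
(* Each of [|p (x2 - x1)|] and [2 |p (w - x1)|] is below [t0], so the factor [1 + mu] costs at most
   [eta / 2]. *)
have [mu [mu0 mu1 mu2]] : exists mu : R,
    [/\ 0 < mu, mu <= 1 / 100 & mu * (2 * t0) <= eta / 2].
  exists (Num.min (1 / 100) (eta / 2 / (2 * t0))); split.
  - by rewrite lt_min !divr_gt0 //; lra.
  - by rewrite ge_min lexx.
  - by rewrite -ler_pdivlMr ?ge_min ?lexx ?orbT //; lra.
have ale : 0 <= eps * al eps by rewrite mulr_ge0 ?al_ge0 //; lra.
have ale2 : 0 <= eps * al (eps / 2) by rewrite mulr_ge0 ?al_ge0 //; lra.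
apply: (le_trans (gammaS_le_gamma0 _ _ d0)); first by lra.
apply: ereal_inf_lbound; exists (eps * (al eps + al (eps / 2)) + eta) => //.
split; first by lra.
move=> x1 x2 S1 S2; have [<- _|x12] := eqVneq x1 x2.
  exists x1; split => //; rewrite /cball /=.
  rewrite -mulr2n -[x1 *+ 2]scaler_nat scalerA mulVf // scale1r subrr normr0.
  lra.
rewrite distrC => le; have [p np] := exN S1.
have t_gt0 : 0 < `|x2 - x1| by rewrite normr_gt0 subr_eq0 eq_sym.
have tlt : 0 < `|x2 - x1| < t0 by lra.
have alt := al_half tlt.
have : 0 <= al `|x2 - x1| by apply: al_ge0; lra.
move=> alt0; have pX := tangent_deviation_lt_half clA al_ge0 al_half S2 np tlt.
have [|w [Sw nw wle]] := midpoint_near_bdry clA np mu0 mu1 x12 pX; first by lra.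
exists w; split => //; rewrite /cball /=; apply: (le_trans wle).
have D1 : `|p (x2 - x1)| <= eps * al eps + eta / 8 by apply: dev1 => //; lra.
have D2 : `|p (w - x1)| <= eps / 2 * al (eps / 2) + eta / 8.
  by apply: dev2 => //; lra.
have := normal_le np (x2 - x1); have := normal_le np (w - x1); rewrite nw.
move=> h1 h2.
have : mu * (`|p (x2 - x1)| + 2 * `|p (w - x1)|) <= mu * (2 * t0).
  by rewrite ler_wpM2l //; lra.
lra.
Qed.

End Modulus.

Theorem theorem5p1 (R : realType) (E : completeNormedModType R)
  (A : set E) (al : R -> R) (r : R) :
  @reflexive_space R E ->
  closed A -> closure (interior A) = A ->
  smooth_surface A al -> simple_surface A r -> 0 < r ->
  weakly_convex_on (bdry A) (Order.min r%:E (eps0 A al)) /\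
  (forall eps : R, 0 <= eps -> eps < r -> (eps%:E < eps0 A al)%E ->
     (gammaS (bdry A) eps <= (eps * (al eps + al (eps / 2)))%:E)%E).
Proof.
move=> _ clA _ smA _ _.
have exN x : bdry A x -> exists p, unit_normal A al x p.
  exact: smooth_surface_normal.
have [_ [[al_ge0 al_cvg] _]] := smA.
have al_small ka : 0 < ka -> exists2 d, 0 < d & forall s, 0 < s < d -> al s <= ka.
  move=> ka0; have /cvgr0Pnorm_le/(_ ka ka0)[d /= d0 dP] := al_cvg.
  exists d => // s /andP[s0 sd]; apply: le_trans (ler_norm _) (dP s _ s0).
  by rewrite /= sub0r normrN gtr0_norm.
(* A member [t0 > eps] of the set defining [eps0] satisfies [t0 <= diam A], which makes [al]
   nonnegative on [[0, t0)]. *)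
have main eps : 0 < eps -> (eps%:E < eps0 A al)%E ->
    al eps + al (eps / 2) < 2^-1 /\
    (gammaS (bdry A) eps <= (eps * (al eps + al (eps / 2)))%:E)%E.
  move=> e0 /ereal_sup_gt[_ [t0 [_ [tdiam thalf]] <-]]; rewrite lte_fin => et.
  have hhalf t : 0 < t < t0 -> al t + al (t / 2) < 2^-1 by exact: thalf.
  split; first by apply: hhalf; rewrite e0.
  apply: (@gammaS_bdry_le _ _ A al t0) => //; last by rewrite e0.
  move=> t /andP[tge tlt]; apply: al_ge0 => //.
  by apply: lt_le_trans tdiam; rewrite lte_fin.
split=> [eps e0|eps e0 _ lt]; last first.
  have [->|ne0] := eqVneq eps 0; first by rewrite /gammaS eqxx mul0r.
  by apply: (main eps _ lt).2; rewrite lt_def ne0.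
(* The strict bound [al eps + al (eps / 2) < 1 / 2] turns the modulus estimate into weak
   convexity. *)
rewrite lt_min => /andP[_ lt]; have [half le] := main _ e0 lt.
by apply: le_lt_trans le _; rewrite lte_fin ltr_pM2l.
Qed.
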